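(* Let $N$ be a positive integer and let $\{\pi(i); i=0,1,\dots,N\}$ be a probability distribution with $\min_{0\le i\le N}\pi(i)>0$. Let $\theta$ be the positive constant defined in the context. Fix a positive integer $b$ with $b>e$, and let the block size of the Read-once-MBD sampler for $\pi$ (described in the context) be $B=b\lceil\theta\rceil N$. Let $T_{\rm R}$ be the running time (number of uniform random variables used) of this sampler and let $\beta(b)=\exp\{1-b/e\}\in(0,1)$. Then $$\mathsf{E}[T_{\rm R}]\le\frac{2b\lceil\theta\rceil N}{1-\beta(b)},$$ $$\mathsf{P}(T_{\rm R}>b\lceil\theta\rceil N k)\le(1-\beta(b))[\beta(b)]^{k-1}k+[\beta(b)]^k\qquad\text{for all integers }k\ge1.$$ In addition, the value of the integer $b>e$ minimizing the right-hand side of the first inequality is equal to six, i.e. $$\arg\min_{b\in\{3,4,5,\dots\}}\frac{2b\lceil\theta\rceil N}{1-\beta(b)}=6.$$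
   Context: Let $\gamma(i)=\pi(i)/\pi(i+1)$ for $0\le i\le N-1$. Define $p_0=\frac{1}{1+\gamma(0)}$, $p_i=\frac{1}{1+\max(\gamma(i),\gamma(i-1))}$ for $1\le i\le N-1$, $p_N=0$; and $q_0=0$, $q_1=\frac{\gamma(0)}{1+\gamma(0)}$, $q_i=\frac{\gamma(i-1)}{1+\max(\gamma(i-1),\gamma(i-2))}$ for $2\le i\le N$. Define $$\theta=\min\left\{\max_{0\le i\le N-1}\left(\frac{1}{p_i}\sum_{m=0}^{i}\frac{\pi(m)}{\pi(i)}\right),\ \max_{0\le i\le N-1}\left(\frac{1}{p_i}\sum_{m=i+1}^{N}\frac{\pi(m)}{\pi(i)}\right)\right\}.$$ Define $\phi:\{0,\dots,N\}\times(0,1)\to\{0,\dots,N\}$ by $\phi(i,u)=i+1$ if $u\in(1-p_i,1)$, $\phi(i,u)=i$ if $u\in[q_i,1-p_i]$, and $\phi(i,u)=i-1$ if $u\in(0,q_i)$. Let $\{U_m;m\in\mathbb{Z}\}$ be i.i.d. random variables uniform on $(0,1)$. For $x\in\{0,\dots,N\}$, a positive integer $B$ (the block size) and an integer $j\ge0$, let $$\Phi_j(x)=\phi(\phi(\cdots\phi(x,U_{jB}),\dots,U_{jB+B-2}),U_{jB+B-1}),$$ i.e. the $B$ variables $U_{jB},\dots,U_{jB+B-1}$ of the $j$-th block are applied successively to $x$. The Read-once-MBD sampler with block size $B$ is the following algorithm. (i) Set $\ell=1$. (ii) If $\Phi_{\ell-1}(0)\ne\Phi_{\ell-1}(N)$,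 increment $\ell$ by one and repeat Step (ii); otherwise set $X=\Phi_{\ell-1}(0)$ and go to Step (iii) with $\ell'=1$. (iii) Set $Y=X$. If $\Phi_{\ell+\ell'-1}(0)\ne\Phi_{\ell+\ell'-1}(N)$, set $X=\Phi_{\ell+\ell'-1}(Y)$, increment $\ell'$ by one and repeat Step (iii); otherwise return $X$. Let $L$ and $L'$ be the numbers of iterations of Steps (ii) and (iii) respectively, i.e. $L=\inf\{\ell\ge1:\Phi_{\ell-1}(0)=\Phi_{\ell-1}(N)\}$ and $L'=\inf\{\ell'\ge1:\Phi_{L+\ell'-1}(0)=\Phi_{L+\ell'-1}(N)\}$. The running time $T_{\rm R}$ is the number of uniform random variables used by the algorithm, so $T_{\rm R}=(L+L')B$. *)

(* Defs.v *)
From HB Require Import structures.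
From mathcomp Require Import all_boot all_order all_algebra.
From mathcomp Require Import all_classical all_reals all_analysis.

Set Implicit Arguments.
Unset Strict Implicit.
Unset Printing Implicit Defensive.

Import Order.TTheory GRing.Theory Num.Theory.
Import numFieldNormedType.Exports.

Local Open Scope classical_set_scope.
Local Open Scope ring_scope.

(* A distribution on {0, ..., N} is a function [dist : nat -> R] of which only
   the values at 0, ..., N are used.  States are natural numbers; [update]
   keeps {0, ..., N} stable because [down_prob 0 = 0] and [up_prob N = 0]. *)
Section chain.
Context {R : realType} (N : nat) (dist : nat -> R).

Definition ratio (i : nat) : R := dist i / dist i.+1.

Definition up_prob (i : nat) : R :=
  if i == 0%N then 1 / (1 + ratio 0)
  else if (i < N)%N then 1 / (1 + Num.max (ratio i) (ratio i.-1))
  else 0.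

Definition down_prob (i : nat) : R :=
  if i == 0%N then 0
  else if i == 1%N then ratio 0 / (1 + ratio 0)
  else ratio i.-1 / (1 + Num.max (ratio i.-1) (ratio i.-2)).

(* The default value 0 of the iterated maxima is harmless: each of them ranges
   over the N >= 1 nonnegative values indexed by 0 <= i <= N - 1. *)
Definition theta : R :=
  Num.min
    (\big[Num.max/0]_(0 <= i < N)
       (1 / up_prob i * \sum_(0 <= m < i.+1) dist m / dist i))
    (\big[Num.max/0]_(0 <= i < N)
       (1 / up_prob i * \sum_(i.+1 <= m < N.+1) dist m / dist i)).

(* [Num.ceil] is integer-valued; theta is positive, so nothing is lost by
   taking the absolute value. *)
Definition ceil_theta : nat := `|Num.ceil theta|%N.

(* Arguments u outside of (0, 1) leave the state unchanged. *)
Definition update (i : nat) (u : R) : nat :=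
  if 1 - up_prob i < u < 1 then i.+1
  else if 0 < u < down_prob i then i.-1
  else i.

(* B is the block size and [u] a realization of the uniform variables. *)
Definition block_map (B : nat) (u : int -> R) (j x : nat) : nat :=
  foldl update x [seq u (j * B + k)%N%:Z | k <- iota 0 B].

Definition coalesces (B : nat) (u : int -> R) (j : nat) : bool :=
  block_map B u j 0 == block_map B u j N.

Local Open Scope ereal_scope.

(* The infimum of the empty set is +oo. *)
Definition iterations_ii (B : nat) (u : int -> R) : \bar R :=
  ereal_inf [set l%:R%:E | l in
    [set l : nat | (1 <= l)%N /\ coalesces B u (l - 1)%N]].

(* Equal to +oo if Step (ii) does not terminate. *)
Definition iterations_iii (B : nat) (u : int -> R) : \bar R :=
  ereal_inf [set l'%:R%:E | l' in
    [set l' : nat | (1 <= l')%N /\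
      exists2 l : nat, iterations_ii B u = l%:R%:E &
                       coalesces B u (l + l' - 1)%N]].

Definition running_time (B : nat) (u : int -> R) : \bar R :=
  (iterations_ii B u + iterations_iii B u) * B%:R%:E.

Local Close Scope ereal_scope.

Definition block_size (b : nat) : nat := (b * ceil_theta * N)%N.

Definition rate (b : nat) : R := expR (1 - b%:R / expR 1).

Definition mean_bound (b : nat) : R :=
  2 * b%:R * ceil_theta%:R * N%:R / (1 - rate b).

End chain.

Arguments rate {R} b.

Definition mutually_independent {R : realType} {d : measure_display}
    {T : measurableType d} (P : probability T R) (I : eqType)
    (X : I -> {RV P >-> R}) : Prop :=
  forall (s : seq I) (A : I -> set R), uniq s ->
    (forall i, i \in s -> measurable (A i)) ->
    (P (\bigcap_(i in [set` s]) (X i @^-1` A i)) =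
     \prod_(i <- s) P (X i @^-1` A i))%E.

Definition iid_uniform {R : realType} {d : measure_display}
    {T : measurableType d} (P : probability T R) (I : eqType)
    (X : I -> {RV P >-> R}) : Prop :=
  mutually_independent X /\
  forall (i : I) (A : set R), measurable A ->
    distribution P (X i) A = uniform_prob (@ltr01 R) A.

(* Main.v *)
Require Import Defs.
From HB Require Import structures.
From mathcomp Require Import all_boot all_order all_algebra.
From mathcomp Require Import all_classical all_reals all_analysis.
From mathcomp Require Import zify ring lra.

Set Implicit Arguments.
Unset Strict Implicit.
Unset Printing Implicit Defensive.

Import Order.TTheory GRing.Theory Num.Theory.
Import numFieldNormedType.Exports.

Local Open Scope classical_set_scope.
Local Open Scope ring_scope.

(* The two paths of a block started at 0 and N never cross, so they have met
   once the lower one has hit N or the upper one has hit 0.  The mean time to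
   hit N from 0 is the sum over i < N of (1 / p_i) sum_(m <= i) pi(m) / pi(i),
   hence at most N times the first maximum in theta; symmetrically for 0 and the
   second maximum.  Markov's inequality over e * ceil(theta) * N steps and the
   Markov property make a block fail to coalesce with probability at most
   beta(b).  Blocks being independent, T_R > B k means that at most one of the
   first k blocks coalesces, which is a binomial probability, increasing in the
   failure probability; summing it over k >= 0 gives the mean.

   Only the random self-map of {0, ..., N} induced by a uniform variable matters.
   It takes finitely many values ("letters"), so probabilities of events on n
   variables are finite sums over words of length n. *)

(** * Numerical bounds on e and minimization over the block factor *)

(** The inequality 1 + x <= exp x at x = 1/64 and at x = -1/64 is squared six times; the
    intermediate fractions are lower bounds rounded down to keep the numbers small. *)
Lemma expR1_bounds (R : realType) : 269/100 <= expR (1 : R) <= 2742/1000.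
Proof.
have e64 : expR 1 = expR (64%:R^-1 : R) ^+ 64.
  by rewrite -expRM_natl mulfV.
have sq (x y : R) : 0 <= x -> x <= y -> x ^+ 2 <= y ^+ 2.
  by move=> x0 xy; rewrite ler_sqr ?nnegrE ?(le_trans x0 xy).
apply/andP; split.
  have h0 : 1 + 64%:R^-1 <= expR (64%:R^-1 : R) by exact: expR_ge1Dx.
  rewrite e64; set x := expR _ in h0 *.
  have h1 : 557/540 <= x ^+ 2 by apply: le_trans (sq _ _ _ h0); lra.
  have h2 : 183/172 <= (x ^+ 2) ^+ 2 by apply: le_trans (sq _ _ _ h1); lra.
  have h3 : 506/447 <= ((x ^+ 2) ^+ 2) ^+ 2
    by apply: le_trans (sq _ _ _ h2); lra.
  have h4 : 551/430 <= (((x ^+ 2) ^+ 2) ^+ 2) ^+ 2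
    by apply: le_trans (sq _ _ _ h3); lra.
  have h5 : 908/553 <= ((((x ^+ 2) ^+ 2) ^+ 2) ^+ 2) ^+ 2
    by apply: le_trans (sq _ _ _ h4); lra.
  have h6 : 269/100 <= (((((x ^+ 2) ^+ 2) ^+ 2) ^+ 2) ^+ 2) ^+ 2
    by apply: le_trans (sq _ _ _ h5); lra.
  by rewrite -!exprM in h6.
have h0 : 1 - 64%:R^-1 <= expR (- (64%:R^-1 : R)) by exact: expR_ge1Dx.
rewrite -[leLHS]invrK -expRN.
have -> : expR (- 1 : R) = expR (- (64%:R^-1 : R)) ^+ 64.
  by rewrite -expRM_natl mulrN mulfV.
set x := expR _ in h0 *.
have h1 : 125/129 <= x ^+ 2 by apply: le_trans (sq _ _ _ h0); lra.
have h2 : 123/131 <= (x ^+ 2) ^+ 2 by apply: le_trans (sq _ _ _ h1); lra.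
have h3 : 67/76 <= ((x ^+ 2) ^+ 2) ^+ 2 by apply: le_trans (sq _ _ _ h2); lra.
have h4 : 143/184 <= (((x ^+ 2) ^+ 2) ^+ 2) ^+ 2
  by apply: le_trans (sq _ _ _ h3); lra.
have h5 : 212/351 <= ((((x ^+ 2) ^+ 2) ^+ 2) ^+ 2) ^+ 2
  by apply: le_trans (sq _ _ _ h4); lra.
have h6 : 143/392 <= (((((x ^+ 2) ^+ 2) ^+ 2) ^+ 2) ^+ 2) ^+ 2
  by apply: le_trans (sq _ _ _ h5); lra.
rewrite -!exprM in h6; change (2 * 2 * 2 * 2 * 2 * 2)%N with 64%N in h6.
move: (x ^+ 64) h6 => y h6.
rewrite -[leRHS]invrK lef_pV2 ?posrE; lra.
Qed.

Lemma rate_gt0 (R : realType) b : 0 < (rate b : R).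
Proof. exact: expR_gt0. Qed.

Lemma rate_lt1 (R : realType) b : expR 1 < b%:R :> R -> (rate b : R) < 1.
Proof.
by move=> eb; rewrite /rate expR_lt1 subr_lt0 ltr_pdivlMr ?expR_gt0// mul1r.
Qed.

(* The tangent to [expR] at [- a], evaluated at [1 - b / e]. *)
Lemma rate_ge (R : realType) (a b : nat) :
  (expR 1)^-1 ^+ a * (a.+2%:R - b%:R * (expR 1)^-1) <= rate b :> R.
Proof.
rewrite /rate (_ : 1 - _ = - a%:R + (a.+1%:R - b%:R / expR 1)); last first.
  by rewrite -natr1; lra.
have -> : (expR 1)^-1 ^+ a = expR (- a%:R) :> R.
  by rewrite -expRN -expRM_natl mulrN1.
rewrite expRD ler_pM2l ?expR_gt0//.
by apply: le_trans (expR_ge1Dx _); rewrite -[a.+2%:R]natr1; lra.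
Qed.

Lemma rate6_le (R : realType) : rate 6 <= 307/1000 :> R.
Proof.
have /andP[elo ehi] := expR1_bounds R.
have e0 : 0 < expR 1 :> R by exact: expR_gt0.
(* the tangent to [expR] at 1 *)
have h : 6 - expR 1 <= (rate 6 : R)^-1.
  rewrite /rate -expRN (_ : - (1 - _) = 1 + (6%:R / expR 1 - 2)); last by lra.
  rewrite expRD; apply: le_trans (_ : expR 1 * (1 + (6%:R / expR 1 - 2)) <= _).
    by rewrite !mulrDr mulr1 [_ * (_ / _)]mulrC divfK ?gt_eqF//; lra.
  by rewrite ler_pM2l// expR_ge1Dx.
move: (rate 6) (rate_gt0 R 6) h => r r0 h.
have : 1000/307 <= r^-1 by lra.
by rewrite -[r^-1]div1r ler_pdivlMr// => hr; lra.
Qed.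

Lemma expR1V_bounds (R : realType) : 500/1371 <= (expR (1 : R))^-1 <= 100/269.
Proof.
move: (expR 1) (expR_gt0 (1 : R)) (expR1_bounds R) => e e0 /andP[elo ehi].
by rewrite -[e^-1]div1r ler_pdivlMr// ler_pdivrMr//; apply/andP; split; lra.
Qed.

(** For b >= 9 the factor b alone exceeds the value at 6. For b <= 5 the tangent of [rate_ge] at -1,
    and for b = 7, 8 the one at -2, bounds [rate b] from below sharply enough. *)
Lemma minimize_block_factor (R : realType) (b : nat) : (3 <= b)%N -> b != 6%N ->
  6%:R / (1 - rate 6) < b%:R / (1 - rate b) :> R.
Proof.
move=> b3 b6.
have /andP[elo ehi] := expR1_bounds R.
have /andP[tlo thi] := expR1V_bounds R.
have rb1 : rate b < 1 :> R.
  apply: rate_lt1; apply: lt_le_trans (_ : 3%:R <= _); first by lra.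
  by rewrite ler_nat.
(* The separating value: 6 / (1 - 0.307) is just below 8.66. *)
apply: (@le_lt_trans _ _ (866/100)).
  by move: (rate 6) (rate6_le R) => r6 hr6; rewrite ler_pdivrMr; lra.
rewrite ltr_pdivlMr ?subr_gt0//.
move: (rate_gt0 R b) (rate_ge R 1 b) (rate_ge R 2 b).
move: (rate b) (expR 1)^-1 tlo thi {elo ehi rb1} => r t tlo thi r0 r1 r2.
(* With t = 1/e, these bound t^2 and t^3 from above by lower powers of t, which brings the
   polynomial tangent bounds within reach of [lra]. *)
have chord : 0 <= (t - 500/1371) * (100/269 - t) by apply: mulr_ge0; lra.
have chordt : 0 <= t * ((t - 500/1371) * (100/269 - t)) by apply: mulr_ge0; lra.
move: b3 b6 r1 r2; case: (leqP 9 b) => [b9 _ _ _ _|].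
  have : 9%:R <= b%:R :> R by rewrite ler_nat.
  by lra.
rewrite expr1 expr2.
do 9 ?[case: b => [|b]//]; move=> _ _ _ r1 r2; lra.
Qed.

(** * Independent letters and hitting times *)

Section iid_words.
Context {R : realType} (C : finType) (p : C -> R).
Hypothesis p_ge0 : forall a, 0 <= p a.
Hypothesis p_sum1 : \sum_a p a = 1.

(** The mean of [F] over words of [n] independent letters of law [p], unfolded by the first letter
    so that conditioning on one step is a reduction. *)
Fixpoint expect (n : nat) (F : seq C -> R) : R :=
  if n is n'.+1 then \sum_a p a * expect n' (fun s => F (a :: s)) else F [::].

Lemma eq_expect n F G :
  (forall s, size s = n -> F s = G s) -> expect n F = expect n G.
Proof.
elim: n F G => [|n IH] F G FG /=; first exact: FG.
by apply: eq_bigr => a _; congr (_ * _); apply: IH => s sn; rewrite FG//= sn.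
Qed.

Lemma expect_cat m n F :
  expect (m + n) F = expect m (fun s => expect n (fun t => F (s ++ t))).
Proof. by elim: m F => [//|m IH] F /=; apply: eq_bigr => a _; rewrite IH. Qed.

Lemma expect_affine n F x y :
  expect n (fun s => F s * x + y) = expect n F * x + y.
Proof.
elim: n F => [//|n IH] F /=.
under eq_bigr do rewrite IH mulrDr mulrA.
by rewrite big_split/= -!mulr_suml p_sum1 mul1r.
Qed.

Lemma expect0 n : expect n (fun=> 0) = 0.
Proof. by elim: n => [//|n IH] /=; rewrite big1// => a _; rewrite IH mulr0. Qed.

Lemma expect_ge0 n F : (forall s, 0 <= F s) -> 0 <= expect n F.
Proof.
elim: n F => [|n IH] F F0 /=; first exact: F0.
by apply: sumr_ge0 => a _; rewrite mulr_ge0// IH.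
Qed.

(** * Number of successes among independent blocks *)

Section successes.
Variables (B : nat) (success : pred (seq C)).

Let failure := expect B (fun s => (~~ success s)%:R).

(** Conditioning on the first block: it fails with probability [failure] and leaves the count
    unchanged, or else adds one to it. *)
Lemma expect_blocksS k (f : nat -> R) :
  expect (k.+1 * B) (fun s => f (count success (reshape (nseq k.+1 B) s))) =
  failure * expect (k * B) (fun s => f (count success (reshape (nseq k B) s))) +
  (1 - failure) *
    expect (k * B) (fun s => f (count success (reshape (nseq k B) s)).+1).
Proof.
set a := expect (k * B) _; set b := expect (k * B) _.
rewrite mulSn expect_cat.
(* Given the first block, the rest has mean [a] after a failure and [b] after a success: an affine
   function of the failure indicator. *)
rewrite (@eq_expect B _ (fun s => (~~ success s)%:R * (a - b) + b)); last first.
  move=> s sB; rewrite /a /b -sB.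
  case: (boolP (success s)) => hs /=; rewrite ?mul0r ?add0r ?mul1r ?subrK;
    by apply: eq_expect => t _; rewrite take_size_cat// drop_size_cat// ?hs ?(negbTE hs).
by rewrite expect_affine -/failure; ring.
Qed.

Lemma expect_no_success k :
  expect (k * B) (fun s => (count success (reshape (nseq k B) s) == 0)%:R) =
  failure ^+ k.
Proof.
elim: k => [|k IH]; first by rewrite expr0.
by rewrite (expect_blocksS _ (fun m => (m == 0)%:R)) IH expect0 mulr0 addr0 exprS.
Qed.

(** The binomial probability of at most one success. At [k = 0] the truncated [k - 1] is harmless,
    being multiplied by [k%:R]. *)
Lemma expect_le1_success k :
  expect (k * B) (fun s => (count success (reshape (nseq k B) s) <= 1)%N%:R) =
  (1 - failure) * failure ^+ (k - 1) * k%:R + failure ^+ k.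
Proof.
elim: k => [|k IH]; first by rewrite expr0 mulr0 add0r.
rewrite (expect_blocksS _ (fun m => (m <= 1)%N%:R)) IH.
under [X in _ + _ * X]eq_expect do rewrite ltnS leqn0.
rewrite expect_no_success subn1 /= exprS -natr1.
case: k {IH} => [|k]; first by rewrite expr0; ring.
by rewrite subn1 /= exprS; ring.
Qed.

End successes.

(** * Tail of a hitting time from a bound on its mean *)

Section hitting.
Context {S : eqType} (act : C -> S -> S) (z : S).

(** The starting state is tested too, so [survival n x] below is the probability that the chain from
    [x] misses [z] at all times 0, ..., n, that is, hits it after time n. *)
Fixpoint avoids (x : S) (s : seq C) : bool :=
  (x != z) && (if s is a :: s' then avoids (act a x) s' else true).

Definition survival n x := expect n (fun s => (avoids x s)%:R).

Lemma survivalS n x :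
  survival n.+1 x = (x != z)%:R * \sum_a p a * survival n (act a x).
Proof.
rewrite /survival /=; case: (x == z) => /=.
  by rewrite mul0r big1// => a _; rewrite expect0 mulr0.
by rewrite mul1r.
Qed.

Lemma survival0 x : survival 0 x = (x != z)%:R.
Proof. by rewrite /survival/= andbT. Qed.

Lemma survival_ge0 n x : 0 <= survival n x.
Proof. by apply: expect_ge0 => s; rewrite ler0n. Qed.

Lemma survival_target n : survival n z = 0.
Proof. by case: n => [|n]; rewrite ?survivalS ?survival0 eqxx ?mul0r. Qed.

Lemma survival_nincr n x : survival n.+1 x <= survival n x.
Proof.
elim: n x => [|n IH] x.
  rewrite survivalS survival0 ler_piMr ?ler0n// -p_sum1 ler_sum// => a _.
  by rewrite survival0 ler_piMr// lern1 leq_b1.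
by rewrite 2!survivalS ler_wpM2l ?ler0n// ler_sum// => a _; rewrite ler_wpM2l.
Qed.

Lemma survival_le m n x : (m <= n)%N -> survival n x <= survival m x.
Proof.
move=> /subnK <-; elim: (n - m)%N => [//|k IH].
exact: le_trans (survival_nincr _ _) IH.
Qed.

(** Markov property at time [m]: a path that has not hit [z] by then survives [n] more steps with
    probability at most [c], wherever it stands. *)
Lemma survivalD m n c x :
  (forall y, survival n y <= c) -> survival (m + n) x <= c * survival m x.
Proof.
move=> hc; elim: m x => [|m IH] x.
  rewrite survival0; case: eqVneq => [->|_]; last by rewrite mulr1 hc.
  by rewrite survival_target mulr0.
rewrite addSn 2!survivalS mulrCA ler_wpM2l ?ler0n// mulr_sumr ler_sum// => a _.
by rewrite mulrCA ler_wpM2l.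
Qed.

Lemma survivalM r k c x :
  (forall y, survival r y <= c) -> survival (k * r) x <= c ^+ k.
Proof.
move=> hc; elim: k x => [|k IH] x.
  by rewrite mul0n survival0 expr0 lern1 leq_b1.
have c0 : 0 <= c by apply: le_trans (hc x); exact: survival_ge0.
by rewrite mulSn addnC exprSr mulrC; apply: le_trans (survivalD _ _ hc) _;
  rewrite ler_wpM2l.
Qed.

Variable h : S -> R.
Hypothesis h_ge0 : forall x, 0 <= h x.
Hypothesis h_drift : forall x, x != z -> \sum_a p a * h (act a x) <= h x - 1.

(** The sum is a truncated mean hitting time. Since [h] drops by at least one in mean at each step
    off [z], it dominates that mean (Foster-Lyapunov), by induction on the first step. *)
Lemma sum_survival_le n x : \sum_(k < n) survival k x <= h x.
Proof.
elim: n x => [|n IH] x; first by rewrite big_ord0.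
case: (eqVneq x z) => [->|xz].
  by rewrite big1// => k _; rewrite survival_target.
rewrite big_ord_recl survival0 xz addrC -lerBrDr.
under eq_bigr do rewrite survivalS xz mul1r.
rewrite exchange_big/=; apply: le_trans (h_drift xz).
by apply: ler_sum => a _; rewrite -mulr_sumr ler_wpM2l.
Qed.

(** Markov's inequality: the n + 1 terms k = 0, ..., n of the preceding sum are all at least the
    last one. *)
Lemma survival_le_mean n x : survival n x <= h x / n.+1%:R.
Proof.
rewrite ler_pdivlMr ?ltr0n// mulr_natr; apply: le_trans (sum_survival_le n.+1 x).
rewrite -[n.+1 in X in X <= _]card_ord -sumr_const ler_sum// => k _.
by rewrite survival_le// -ltnS.
Qed.

(* Over [floor (e M)] steps the survival probability drops to [1 / e] by
   Markov's inequality, and [b M] steps contain [floor (b / e)] such spans. *)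
Lemma survival_le_rate (M b : nat) x : (0 < M)%N ->
  (forall y, h y <= M%:R) -> survival (b * M) x <= rate b.
Proof.
move=> M0 hM.
have e0 : 0 < expR 1 :> R by exact: expR_gt0.
set r := Num.truncn (expR 1 * M%:R : R); set k := Num.truncn (b%:R / expR 1 : R).
have r_le : r%:R <= expR 1 * M%:R :> R by rewrite /r truncn_le mulr_ge0 ?(ltW e0) ?ler0n.
have k_le : k%:R <= b%:R / expR 1 :> R by rewrite /k truncn_le divr_ge0 ?(ltW e0) ?ler0n.
have r_gt : expR 1 * M%:R < r.+1%:R :> R by rewrite truncnS_gt.
have k_gt : b%:R / expR 1 < k.+1%:R :> R by rewrite truncnS_gt.
(* Rounding down in [r] costs nothing: the Markov bound divides by [r.+1], which exceeds e M. *)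
have sr y : survival r y <= (expR 1)^-1.
  apply: le_trans (survival_le_mean _ _) _.
  rewrite ler_pdivrMr ?ltr0n//; apply: le_trans (hM y) _.
  by rewrite ler_pdivlMl// ltW.
apply: le_trans (_ : survival (k * r) x <= _).
  apply: survival_le; rewrite -(ler_nat R) !natrM.
  apply: le_trans (ler_pM _ _ k_le r_le) _ => //.
  by rewrite mulrA divfK ?gt_eqF.
apply: le_trans (survivalM _ _ sr) _.
(* Here k + 1 > b / e gives exp (-k) <= exp (1 - b / e); the 1 in [rate] pays for rounding down in
   [k]. *)
rewrite -expRN -expRM_natl ler_expR mulrN1.
by move: k_gt; rewrite -natr1; lra.
Qed.

End hitting.
End iid_words.

(** * The birth-death chain *)

Lemma le_bigmax_below (R : realDomainType) (F : nat -> R) n i :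
  (i < n)%N -> F i <= \big[Num.max/0]_(0 <= j < n) F j.
Proof. by move=> iN; apply: le_bigmax_seq; rewrite ?mem_index_iota. Qed.

Section birth_death.
Context {R : realType} (N : nat) (dist : nat -> R).
Hypothesis N_gt0 : (0 < N)%N.
Hypothesis dist_gt0 : forall i, (i <= N)%N -> 0 < dist i.

Local Notation ratio := (Defs.ratio dist).
Local Notation up := (up_prob N dist).
Local Notation down := (down_prob dist).
Local Notation update := (update N dist).
Local Notation state := 'I_N.+1.
Local Notation letter := {ffun state -> state}.

Lemma ratio_gt0 i : (i < N)%N -> 0 < ratio i.
Proof. by move=> iN; rewrite divr_gt0// dist_gt0// ltnW. Qed.

Lemma up_prob_last : up N = 0.
Proof. by rewrite /up_prob eqn0Ngt N_gt0 ltnn. Qed.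

Lemma up_prob_gt0 i : (i < N)%N -> 0 < up i.
Proof.
move=> iN; have r0 := ratio_gt0 iN; rewrite /up_prob iN.
case: ifPn => [/eqP i0|_]; first by rewrite divr_gt0// addr_gt0// ratio_gt0.
by rewrite divr_gt0// addr_gt0// lt_max r0.
Qed.

(** Detailed balance with respect to [dist], uniform in [i]: the special case in the definition of
    [down_prob] at 1 is absorbed. *)
Lemma down_probS i : (i < N)%N -> down i.+1 = ratio i * up i.
Proof.
by move=> iN; rewrite /down_prob /up_prob iN; case: i {iN} => [|i] /=;
  rewrite mul1r.
Qed.

Lemma up_prob_le i : (i < N)%N -> up i * (1 + ratio i) <= 1.
Proof.
move=> iN; have r0 := ratio_gt0 iN; rewrite /up_prob iN.
case: ifPn => [/eqP i0|_]; rewrite mul1r mulrC ler_pdivrMr.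
- by rewrite mul1r i0.
- by rewrite addr_gt0// ratio_gt0.
- by rewrite mul1r lerD2l le_max lexx.
- by rewrite addr_gt0// lt_max r0.
Qed.

Lemma up_probS_le i : (i < N)%N -> up i.+1 * (1 + ratio i) <= 1.
Proof.
move=> iN; have r0 := ratio_gt0 iN; rewrite /up_prob /=.
case: ifPn => [_|_]; last by rewrite mul0r.
rewrite mul1r mulrC ler_pdivrMr.
  by rewrite mul1r lerD2l le_max lexx orbT.
by rewrite addr_gt0// lt_max r0 orbT.
Qed.

Lemma up_prob_ge0 i : (i <= N)%N -> 0 <= up i.
Proof.
rewrite leq_eqVlt => /predU1P[->|/up_prob_gt0/ltW//].
by rewrite up_prob_last.
Qed.

Lemma down_prob_ge0 i : (i <= N)%N -> 0 <= down i.
Proof.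
case: i => [|i] iN; first by rewrite /down_prob.
by rewrite down_probS// mulr_ge0 ?ltW ?ratio_gt0 ?up_prob_gt0.
Qed.

(** The uniform values that raise [i] and those that lower [i.+1] are thus disjoint, so neighbours
    never swap. *)
Lemma up_down_adjacent i : (i < N)%N -> up i + down i.+1 <= 1.
Proof. by move=> iN; rewrite down_probS//; have := up_prob_le iN; lra. Qed.

(** With g = [ratio i], the maxima in [up_prob] give p_(i+1) <= 1 / (1 + g) and q_(i+1) = g p_i <= g
    / (1 + g). *)
Lemma up_down_le1 i : (i <= N)%N -> up i + down i <= 1.
Proof.
case: i => [|i] iN.
  have := up_prob_le N_gt0; have := up_prob_gt0 N_gt0.
  have := ratio_gt0 N_gt0; rewrite /down_prob/=; nra.
rewrite down_probS//; have r0 := ratio_gt0 iN.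
rewrite -(ler_pM2r (addr_gt0 ltr01 r0)) mul1r.
have := up_prob_le iN; have := up_probS_le iN.
move: (up i) (up i.+1) => x y hy hx.
have : ratio i * (x * (1 + ratio i)) <= ratio i * 1 by rewrite ler_wpM2l// ltW.
lra.
Qed.

Lemma update_le x u : (x <= N)%N -> (update x u <= N)%N.
Proof.
move=> xN; rewrite /update; case: ifPn => [/andP[h1 h2]|_].
  rewrite ltn_neqAle xN andbT; apply: contraTneq h2 => xE.
  by move: h1; rewrite xE up_prob_last subr0 -leNgt => /ltW.
by case: ifPn => // _; apply: leq_trans xN; exact: leq_pred.
Qed.

(** Moves have size at most one, so states at distance two or more cannot cross; neighbours are
    handled by [up_down_adjacent]. *)
Lemma update_mono x y u : (x <= y)%N -> (y <= N)%N ->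
  (update x u <= update y u)%N.
Proof.
rewrite leq_eqVlt => /predU1P[->//|xy] yN.
have ux : (update x u <= x.+1)%N.
  by rewrite /update; case: ifP => // _; case: ifP => _; lia.
have uy : (y.-1 <= update y u)%N.
  by rewrite /update; case: ifP => _; [|case: ifP => _]; lia.
move: (xy); rewrite leq_eqVlt => /predU1P[yE|xy2]; last first.
  by apply: leq_trans ux _; apply: leq_trans uy; lia.
subst y; have := up_down_adjacent yN; move: ux uy; rewrite /update/=.
case: ifP => [/andP[h1 _]|_]; case: ifP => // _.
  by case: ifP => // /andP[_ h2]; lra.
by do 2?[case: ifP => _]; lia.
Qed.

(** By [update_le], [inord] always receives a value at most [N] and so keeps it. *)
Definition letter_of (u : R) : letter := [ffun x => inord (update (val x) u)].

Definition apply_letter (a : letter) (x : state) : state := a x.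

Definition apply_word (x : state) (s : seq letter) : state :=
  foldl (fun y (a : letter) => a y) x s.

Lemma letter_ofE u x : letter_of u x = update x u :> nat.
Proof. by rewrite ffunE inordK ?ltnS ?update_le ?leq_ord. Qed.

Lemma apply_wordE us x :
  apply_word x (map letter_of us) = foldl update x us :> nat.
Proof. by elim: us x => [//|u us IH] x /=; rewrite IH letter_ofE. Qed.

(* Once the lower path is at [N] or the upper one at [0], the two paths, which
   never cross, have met. *)
Lemma coupled_avoids us (x y : state) : (x <= y)%N ->
  apply_word x (map letter_of us) != apply_word y (map letter_of us) ->
  avoids apply_letter ord_max x (map letter_of us) /\
  avoids apply_letter ord0 y (map letter_of us).
Proof.
elim: us x y => [|u us IH] x y xy /= hne.
  have hlt : (x < y)%N by rewrite ltn_neqAle xy andbT.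
  rewrite !andbT; split; apply: contraTneq hlt => ->; rewrite -leqNgt//=.
  by rewrite -ltnS.
have xyne : x != y by apply: contraNneq hne => ->.
have hlt : (x < y)%N by rewrite ltn_neqAle xy andbT.
have [|h1 h2] := IH (letter_of u x) (letter_of u y) _ hne.
  by rewrite !letter_ofE update_mono ?leq_ord.
rewrite h1 h2 !andbT; split; apply: contraTneq hlt => ->; rewrite -leqNgt//=.
by rewrite -ltnS.
Qed.

(** The mean time to pass from i to i + 1; [mean_down i] is the mean time from i + 1 to i, rewritten
    by detailed balance in terms of p_i. *)
Definition mean_up i := 1 / up i * \sum_(0 <= m < i.+1) dist m / dist i.
Definition mean_down i :=
  1 / up i * \sum_(i.+1 <= m < N.+1) dist m / dist i.

Definition hit_last_mean (x : nat) : R := \sum_(x <= i < N) mean_up i.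
Definition hit_first_mean (x : nat) : R := \sum_(0 <= i < x) mean_down i.

Lemma mean_up_gt0 i : (i < N)%N -> 0 < mean_up i.
Proof.
move=> iN; rewrite /mean_up mulr_gt0 ?divr_gt0 ?up_prob_gt0// -mulr_suml divr_gt0//.
  rewrite big_nat_recr//= ltr_wpDl ?dist_gt0 1?ltnW// big_nat sumr_ge0// => m.
  by move=> /andP[_ mi]; rewrite ltW// dist_gt0//; lia.
by rewrite dist_gt0// ltnW.
Qed.

Lemma mean_down_gt0 i : (i < N)%N -> 0 < mean_down i.
Proof.
move=> iN; rewrite /mean_down mulr_gt0 ?divr_gt0 ?up_prob_gt0// -mulr_suml divr_gt0//.
  rewrite big_nat_recr//= ltr_wpDl ?dist_gt0// big_nat sumr_ge0// => m.
  by move=> /andP[_ mi]; rewrite ltW// dist_gt0//; lia.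
by rewrite dist_gt0// ltnW.
Qed.

Lemma theta_gt0 : 0 < theta N dist.
Proof.
rewrite /theta lt_min; apply/andP; split.
  exact: lt_le_trans (mean_up_gt0 N_gt0) (le_bigmax_below mean_up N_gt0).
exact: lt_le_trans (mean_down_gt0 N_gt0) (le_bigmax_below mean_down N_gt0).
Qed.

Lemma hit_last_mean_ge0 x : 0 <= hit_last_mean x.
Proof.
rewrite /hit_last_mean big_nat sumr_ge0// => i /andP[_ iN].
exact/ltW/mean_up_gt0.
Qed.

Lemma hit_first_mean_ge0 x : (x <= N)%N -> 0 <= hit_first_mean x.
Proof.
move=> xN; rewrite /hit_first_mean big_nat sumr_ge0// => i /andP[_ ix].
by apply/ltW/mean_down_gt0; exact: leq_trans xN.
Qed.

(** The differences telescope to -p_x [mean_up x] + q_x [mean_up x.-1], which detailed balance turns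
    into -1; at x = 0 the second term vanishes. *)
Lemma hit_last_mean_drift x : (x < N)%N ->
  up x * (hit_last_mean x.+1 - hit_last_mean x) +
  down x * (hit_last_mean x.-1 - hit_last_mean x) = - 1.
Proof.
move=> xN; have ux := up_prob_gt0 xN; have dx := dist_gt0 (ltnW xN).
rewrite /hit_last_mean (big_ltn xN).
case: x xN ux dx => [|x] xN ux dx /=.
  rewrite /mean_up -mulr_suml big_nat1 /down_prob/=; field.
  by rewrite !gt_eqF.
have xN' := ltnW xN; have ux' := up_prob_gt0 xN'.
have dx' := dist_gt0 (ltnW xN').
rewrite (big_ltn xN') (big_ltn xN) /mean_up -!mulr_suml.
rewrite (big_nat_recr x.+1)//= down_probS// /Defs.ratio; field.
by rewrite !gt_eqF.
Qed.

Lemma hit_first_mean_drift x : (0 < x <= N)%N ->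
  up x * (hit_first_mean x.+1 - hit_first_mean x) +
  down x * (hit_first_mean x.-1 - hit_first_mean x) = - 1.
Proof.
case: x => [//|x] /= xN; have ux := up_prob_gt0 xN.
have dx := dist_gt0 xN; have dx' := dist_gt0 (ltnW xN).
rewrite /hit_first_mean 2?big_nat_recr//= /mean_down -!mulr_suml down_probS// /Defs.ratio.
rewrite (big_ltn (_ : x.+1 < N.+1)%N)//.
(* The top state is separate: p_N = 0 cannot be inverted by [field], but it kills the upward term,
   and the remaining tail sum is empty. *)
move: xN; rewrite leq_eqVlt => /predU1P[xN|xN].
  rewrite xN up_prob_last (big_geq (leqnn N.+1)) mul0r add0r.
  rewrite xN in dx; field.
  by rewrite !gt_eqF.
have := up_prob_gt0 xN => ux'; field.
by rewrite !gt_eqF.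
Qed.

Lemma hit_last_mean_le x :
  hit_last_mean x <= N%:R * \big[Num.max/0]_(0 <= i < N) mean_up i.
Proof.
rewrite mulr_natl; set m := \big[_/_]_(_ <= _ < _) _.
have m0 : 0 <= m by exact: bigmax_ge_id.
apply: (@le_trans _ _ (\sum_(x <= i < N) m)).
  rewrite /hit_last_mean big_nat [leRHS]big_nat ler_sum// => i /andP[_ iN].
  exact: le_bigmax_below.
by rewrite big_const_nat iter_addr_0 ler_wpMn2l// leq_subr.
Qed.

Lemma hit_first_mean_le x : (x <= N)%N ->
  hit_first_mean x <= N%:R * \big[Num.max/0]_(0 <= i < N) mean_down i.
Proof.
move=> xN; rewrite mulr_natl; set m := \big[_/_]_(_ <= _ < _) _.
have m0 : 0 <= m by exact: bigmax_ge_id.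
apply: (@le_trans _ _ (\sum_(0 <= i < x) m)).
  rewrite /hit_first_mean big_nat [leRHS]big_nat ler_sum// => i /andP[_ ix].
  by apply: le_bigmax_below; exact: leq_trans xN.
by rewrite big_const_nat iter_addr_0 ler_wpMn2l// subn0.
Qed.

Lemma le_ceil_theta : theta N dist <= (ceil_theta N dist)%:R.
Proof.
apply: le_trans (ceil_ge _) _.
rewrite /ceil_theta natr_absz ger0_norm//.
by rewrite ceil_ge0 (lt_trans _ theta_gt0)// ltrN10.
Qed.

Lemma ceil_theta_gt0 : (0 < ceil_theta N dist)%N.
Proof. by rewrite -(ltr_nat R) (lt_le_trans theta_gt0)// le_ceil_theta. Qed.

End birth_death.

(** * From uniform variables to words *)

Lemma uniform_prob_itv (R : realType) (a b : R) : 0 <= a -> a <= b -> b <= 1 ->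
  uniform_prob (@ltr01 R) `]a, b[%classic = (b - a)%:E.
Proof.
move=> a0 ab b1; rewrite /uniform_prob.
rewrite (eq_integral (fun=> 1%:E)); last first.
  move=> x; rewrite inE/= in_itv/= /uniform_pdf => /andP[ax xb].
  by rewrite subr0 invr1 (le_trans a0 (ltW ax)) (le_trans (ltW xb) b1).
rewrite integral_cst//= mul1e lebesgue_measure_itv/= lte_fin.
case: ltP => // ba; have -> : a = b by apply/eqP; rewrite eq_le ab.
by rewrite subrr.
Qed.

Section finite_letters.
Context {R : realType} {d : measure_display} {T : measurableType d}
  (P : probability T R) (U : int -> {RV P >-> R}) (hU : iid_uniform U).
Context (C : finType) (c : R -> C).
Hypothesis mc : forall a, measurable (c @^-1` [set a]).

Definition law (a : C) : R := fine (uniform_prob (@ltr01 R) (c @^-1` [set a])).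

Definition word (i n : nat) (w : T) : seq C :=
  [seq c (U m%:Z w) | m <- iota i n].

Lemma law_ge0 a : 0 <= law a.
Proof. by rewrite fine_ge0. Qed.

(** Identities under the sum over letters need checking only for letters induced by some uniform
    value. *)
Lemma law_neq0 a : law a != 0 -> exists u, c u = a.
Proof.
apply: contra_neqP => /forallNP ca; rewrite /law (_ : _ @^-1` _ = set0).
  by rewrite measure0.
by apply/seteqP; split => // u /ca.
Qed.

Let PU_letter i a : P (U i @^-1` (c @^-1` [set a])) = (law a)%:E.
Proof.
have := hU.2 i _ (mc a); rewrite /law => <-.
by rewrite fineK// fin_num_measure.
Qed.

Lemma measurable_letter i a : measurable [set w | c (U i w) = a].
Proof. exact: (measurable_funPTI (U i) (mc a)). Qed.

Let word_eventS i n (E : pred (seq C)) :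
  [set w | E (word i n.+1 w)] =
  \bigcup_(a : C) ([set w | c (U i%:Z w) = a] `&`
                   [set w | E (a :: word i.+1 n w)]).
Proof.
apply/seteqP; split => w /=; first by exists (c (U i%:Z w)).
by move=> [a _ [<-]].
Qed.

Lemma measurable_word_event i n (E : pred (seq C)) :
  measurable [set w | E (word i n w)].
Proof.
elim: n i E => [|n IH] i E.
  case: (boolP (E [::])) => hE.
    by rewrite [X in measurable X](_ : _ = setT)//; apply/seteqP; split.
  rewrite [X in measurable X](_ : _ = set0)//.
  by apply/seteqP; split => // w /=; rewrite /word/= (negbTE hE).
rewrite word_eventS; apply: fin_bigcup_measurable; first exact: finite_finset.
move=> a _; apply: measurableI; first exact: measurable_letter.
exact: (IH i.+1 (fun s => E (a :: s))).
Qed.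

Let prob_cylinder (s : seq C) :
  P [set w | word 0 (size s) w = s] = (\prod_(a <- s) law a)%:E.
Proof.
pose A (i : int) := c @^-1` [set nth (c 0) s `|i|%N].
have -> : [set w | word 0 (size s) w = s] =
    \bigcap_(i in [set` [seq m%:Z | m <- iota 0 (size s)]]) (U i @^-1` A i).
  apply/seteqP; split => w /=.
    move=> ws i /mapP[m]; rewrite mem_iota add0n /= => ms -> /=.
    rewrite /A /= -[RHS](congr1 (fun t => nth (c 0) t m) ws).
    by rewrite (nth_map 0%N) ?size_iota// nth_iota.
  move=> h; apply: (@eq_from_nth _ (c 0)); rewrite size_map size_iota// => m ms.
  rewrite (nth_map 0%N) ?size_iota// nth_iota// add0n.
  by apply: (h m%:Z); rewrite /= map_f// mem_iota.
rewrite hU.1 ?map_inj_uniq ?iota_uniq//; [|by move=> m n []|by move=> i _; exact: mc].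
rewrite big_map (big_nth (c 0)) /index_iota subn0.
rewrite (eq_bigr (fun m => (law (nth (c 0) s m))%:E)); last first.
  by move=> m _; rewrite PU_letter.
by elim: (iota _ _) => [|m r IH]; rewrite ?big_nil// !big_cons IH.
Qed.

(** The fixed prefix [s] makes the induction on [n] work: the next letter is moved to its end, until
    independence applies to the full word in [prob_cylinder]. *)
Let prob_cylinder_event n (s : seq C) (E : pred (seq C)) :
  P ([set w | word 0 (size s) w = s] `&` [set w | E (word (size s) n w)]) =
  (\prod_(a <- s) law a * expect law n (fun t => (E t)%:R))%:E.
Proof.
elim: n s E => [|n IH] s E /=.
  case: (E [::]); last first.
    by rewrite mulr0 [X in P X](_ : _ = set0) ?measure0//; apply/seteqP; split => // w [].
  by rewrite mulr1 -prob_cylinder; congr (P _); apply/seteqP; split => // w [].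
rewrite word_eventS setI_bigcupr measure_fin_bigcup//=; last 2 first.
- by move=> a b _ _ [w [[_ [<- _]] [_ [<- _]]]].
- move=> a _; apply: measurableI.
    rewrite [X in measurable X](_ : _ = [set w | word 0 (size s) w == s]).
      exact: (measurable_word_event _ _ (fun t => t == s)).
    by apply/seteqP; split => w /= /eqP.
  apply: measurableI; first exact: measurable_letter.
  exact: (measurable_word_event _ _ (fun t => E (a :: t))).
rewrite (_ : [set: C] = [set` index_enum C]); last first.
  by apply/seteqP; split => // a _; rewrite /= mem_index_enum.
rewrite -fsbig_seq ?index_enum_uniq// mulr_sumr -sumEFin.
apply: eq_bigr => a _; rewrite mulrA -big_rcons/=.
have := IH (rcons s a) (fun t => E (a :: t)); rewrite size_rcons => <-.
rewrite setIA; congr (P (_ `&` _)); apply/seteqP; split => w /=.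
  by move=> [ws ca]; rewrite /word -addn1 iotaD map_cat -/(word _ _ _) ws/= ca cats1.
rewrite /word -addn1 iotaD map_cat -/(word _ _ _)/= cats1 => /eqP.
by rewrite eqseq_rcons => /andP[/eqP-> /eqP].
Qed.

Lemma prob_word_event n (E : pred (seq C)) :
  P [set w | E (word 0 n w)] = (expect law n (fun t => (E t)%:R))%:E.
Proof.
have := prob_cylinder_event n [::] E; rewrite big_nil mul1r => <-.
by congr (P _); apply/seteqP; split => // w [].
Qed.

Lemma law_sum1 : \sum_a law a = 1.
Proof.
have := prob_word_event 1 xpredT; rewrite /= [X in P X](_ : _ = setT); last first.
  by apply/seteqP; split.
by rewrite probability_setT => -[->]; apply: eq_bigr => a _; rewrite mulr1.
Qed.

(** Gives the mass of a set of letters as that of a set of reals, without the law of any single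
    letter. *)
Lemma law_pred (Q : pred C) (A : set R) : measurable A ->
  (forall u, Q (c u) <-> A u) ->
  \sum_a law a * (Q a)%:R = fine (uniform_prob (@ltr01 R) A).
Proof.
move=> mA QA; have := prob_word_event 1 (fun s => if s is a :: _ then Q a else false).
rewrite /= [X in P X](_ : _ = U 0 @^-1` A); last first.
  by apply/seteqP; split => w /= /QA.
by have := hU.2 0 _ mA; rewrite /distribution/pushforward/= => -> ->.
Qed.

End finite_letters.

Lemma reshape_map_iota (A : Type) (f : nat -> A) i k B :
  reshape (nseq k B) [seq f m | m <- iota i (k * B)] =
  [seq [seq f m | m <- iota (i + j * B) B] | j <- iota 0 k].
Proof.
elim: k i => [//|k IH] i /=; rewrite mulSn iotaD map_cat addn0.
rewrite take_size_cat ?drop_size_cat ?size_map ?size_iota//; congr cons.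
rewrite IH -[1%N]addn0 iotaDl -map_comp; apply: eq_map => j /=.
by rewrite add1n mulSn addnA.
Qed.

(** * Coalescence of one block and of the first k blocks *)

Section sampler.
Context {R : realType} (N : nat) (dist : nat -> R).
Hypothesis N_gt0 : (0 < N)%N.
Hypothesis dist_gt0 : forall i, (i <= N)%N -> 0 < dist i.
Context {d : measure_display} {T : measurableType d} (P : probability T R)
  (U : int -> {RV P >-> R}) (hU : iid_uniform U).

Local Notation up := (up_prob N dist).
Local Notation down := (down_prob dist).
Local Notation update := (update N dist).
Local Notation state := 'I_N.+1.
Local Notation letter := {ffun state -> state}.
Local Notation letter_of := (@letter_of R N dist).
Local Notation law := (law letter_of).
Local Notation word := (word U letter_of).
Local Notation coalescence B w j :=
  (coalesces N dist B (fun m => U m w) j).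

Lemma measurable_letter_of a : measurable (letter_of @^-1` [set a]).
Proof.
rewrite (_ : _ @^-1` _ =
  \bigcap_(x : state) (update (val x) @^-1` [set y | inord y = a x])); last first.
  apply/seteqP; split => u /=; first by move=> <- x _ /=; rewrite ffunE.
  by move=> h; apply/ffunP => x; rewrite ffunE h.
apply: fin_bigcap_measurable; first exact: finite_finset.
move=> x _; rewrite -[X in measurable X]setTI.
suff mf : measurable_fun setT (update (val x)) by exact: (mf measurableT).
have mitv a' b' : measurable_fun setT (fun u : R => a' < u < b').
  by apply: measurable_and; exact: measurable_realfun.measurable_fun_ltr.
rewrite /Defs.update; apply: measurable_fun_if => //.
apply: measurable_fun_if => //; first exact: mitv.
exact: measurable_funTS.
Qed.

Let law_ge0 a : 0 <= law a. Proof. exact: law_ge0. Qed.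

Let law_sum : \sum_a law a = 1.
Proof. exact: (law_sum1 hU measurable_letter_of). Qed.

Lemma law_step (H : nat -> R) (x : state) :
  \sum_a law a * H (a x) =
  H x + (up x * (H x.+1 - H x) + down x * (H x.-1 - H x)).
Proof.
have xN : (x <= N)%N by exact: leq_ord.
have up0 := up_prob_ge0 N_gt0 dist_gt0 xN.
have dn0 := down_prob_ge0 N_gt0 dist_gt0 xN.
have ud := up_down_le1 N_gt0 dist_gt0 xN.
have law_up : \sum_a law a * (x < a x)%N%:R = up x.
  rewrite (law_pred hU measurable_letter_of (Q := fun a => (x < a x)%N)
    (A := `]1 - up x, 1[%classic)) //.
    by rewrite uniform_prob_itv/=; lra.
  move=> u; rewrite letter_ofE//= in_itv/= /Defs.update.
  by case: ifP => // _; case: ifP => _; split => //; lia.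
have law_down : \sum_a law a * (a x < x)%N%:R = down x.
  rewrite (law_pred hU measurable_letter_of (Q := fun a => (a x < x)%N)
    (A := `]0, down x[%classic)) //.
    by rewrite uniform_prob_itv/=; lra.
  move=> u; rewrite letter_ofE//= in_itv/= /Defs.update.
  case: ifP => [/andP[h1 h2]|_].
    split => [|/andP[h3 h4]]; first by lia.
    by move: h1 h4; lra.
  case: ifP => [/andP[h1 h2]|_]; last by rewrite ltnn.
  split => // _; case: (nat_of_ord x) h2 => [|y]; last by rewrite leqnn.
  by rewrite /down_prob/= => h2; lra.
rewrite -[in RHS]law_up -[in RHS]law_down !mulr_suml.
(* [H x] is multiplied by the total mass 1, so that both sides are sums over letters, compared term
   by term. *)
rewrite -[X in _ = X + _]mul1r -[X in _ = X * _ + _]law_sum mulr_suml -!big_split/=.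
apply: eq_bigr => a _; case: (eqVneq (law a) 0) => [->|].
  by rewrite !mul0r !addr0.
move=> /law_neq0[u <-]; rewrite letter_ofE//= /Defs.update -!mulrA -!mulrDr.
congr (_ * _).
case: ifP => [_|_].
  by rewrite ltnSn ltnNge leqnSn mulr1n mulr0n; ring.
case: ifP => [/andP[u0 hu]|_]; last by rewrite ltnn mulr0n; ring.
case: (nat_of_ord x) hu => [|y _]; first by rewrite /down_prob/= => hu; lra.
by rewrite /= ltnSn ltnNge leqnSn mulr1n mulr0n; ring.
Qed.

Definition coalescing (s : seq letter) : bool :=
  apply_word ord0 s == apply_word ord_max s.

Definition failure (B : nat) : R := expect law B (fun s => (~~ coalescing s)%:R).

Lemma coalescenceE B w j :
  coalescence B w j = coalescing (word (j * B) B w).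
Proof.
rewrite /coalesces /block_map /coalescing -(inj_eq val_inj) /=.
have -> : word (j * B) B w =
    map letter_of [seq (U (j * B + k)%N%:Z w) | k <- iota 0 B].
  by rewrite /word -map_comp -[(j * B)%N in LHS]addn0 iotaDl -map_comp.
by rewrite !apply_wordE.
Qed.

Lemma failure_ge0 B : 0 <= failure B.
Proof. by apply: expect_ge0 => // s; rewrite ler0n. Qed.

Lemma failure_le_survival B :
  failure B <= survival law (@apply_letter N) ord_max B ord0 /\
  failure B <= survival law (@apply_letter N) ord0 B ord_max.
Proof.
have E0 (w : T) : ~~ coalescing (word 0 B w) ->
    avoids (@apply_letter N) ord_max ord0 (word 0 B w) /\
    avoids (@apply_letter N) ord0 ord_max (word 0 B w).
  by rewrite /word (map_comp letter_of) => h; exact: coupled_avoids.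
(* The comparison passes through [P] because [E0] holds only for words produced by uniform
   variables; an arbitrary letter need not preserve order. *)
have le_expect (E F : pred (seq letter)) :
    (forall w, E (word 0 B w) -> F (word 0 B w)) ->
    expect law B (fun s => (E s)%:R) <= expect law B (fun s => (F s)%:R).
  move=> EF; rewrite -lee_fin -!(prob_word_event hU measurable_letter_of).
  by apply: le_measure => [| |w /EF//]; rewrite inE;
    exact: measurable_word_event measurable_letter_of _ _ _.
by split; apply: (le_expect (fun s => ~~ coalescing s)) => w /E0[].
Qed.

Lemma failure_le_rate b : failure (block_size N dist b) <= rate b.
Proof.
have th_le : N%:R * theta N dist <= (ceil_theta N dist * N)%:R.
  by rewrite natrM mulrC ler_wpM2r// le_ceil_theta.
have M0 : (0 < ceil_theta N dist * N)%N by rewrite muln_gt0 ceil_theta_gt0.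
have [f_last f_first] := failure_le_survival (block_size N dist b).
rewrite /block_size -mulnA in f_last f_first *.
(* The maximum attaining [theta] decides which path is followed: the lower one up to [N] or the
   upper one down to 0. *)
move: th_le; rewrite {1}/theta /Num.min; case: ifP => _ th_le.
  apply: le_trans f_last _.
  apply: (survival_le_rate _ _ (h := fun x : state => hit_last_mean N dist x)) => //.
  - by move=> x; exact: hit_last_mean_ge0.
  - move=> x xN; rewrite law_step hit_last_mean_drift//.
    by rewrite ltn_neqAle leq_ord andbT; apply: contraNneq xN => xN; apply/eqP/val_inj.
  - by move=> x; apply: le_trans th_le; exact: hit_last_mean_le.
apply: le_trans f_first _.
apply: (survival_le_rate _ _ (h := fun x : state => hit_first_mean N dist x)) => //.
- by move=> x; apply: hit_first_mean_ge0; rewrite ?leq_ord.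
- move=> x x0; rewrite law_step hit_first_mean_drift// leq_ord andbT lt0n.
  by apply: contraNneq x0 => x0; apply/eqP/val_inj.
- by move=> x; apply: le_trans th_le; apply: hit_first_mean_le; rewrite ?leq_ord.
Qed.

Lemma count_coalescence B k w :
  count (fun j => coalescence B w j) (iota 0 k) =
  count coalescing (reshape (nseq k B) (word 0 (k * B) w)).
Proof.
rewrite reshape_map_iota count_map; apply: eq_count => j /=.
by rewrite coalescenceE add0n.
Qed.

Let le1_success B k s := (count coalescing (reshape (nseq k B) s) <= 1)%N.

Let le1_coalescenceE B k :
  [set w | (count (fun j => coalescence B w j) (iota 0 k) <= 1)%N] =
  [set w | le1_success B k (word 0 (k * B) w)].
Proof. by apply/seteqP; split => w /=; rewrite count_coalescence. Qed.

Lemma measurable_le1_coalescence B k :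
  measurable [set w | (count (fun j => coalescence B w j) (iota 0 k) <= 1)%N].
Proof.
by rewrite le1_coalescenceE; exact: measurable_word_event measurable_letter_of _ _ _.
Qed.

Lemma prob_le1_coalescence B k :
  P [set w | (count (fun j => coalescence B w j) (iota 0 k) <= 1)%N] =
  ((1 - failure B) * failure B ^+ (k - 1) * k%:R + failure B ^+ k)%:E.
Proof.
rewrite le1_coalescenceE (prob_word_event hU measurable_letter_of).
by rewrite expect_le1_success.
Qed.

End sampler.

(** * Two geometric waiting times *)

(** Induction on the recursion f (k+1) = z f k + (1 - z) z^k, obtained by conditioning on one
    trial. *)
Lemma two_success_tail_le (R : realType) (x y : R) k : 0 <= x -> x <= y -> y <= 1 ->
  (1 - x) * x ^+ (k - 1) * k%:R + x ^+ k <= (1 - y) * y ^+ (k - 1) * k%:R + y ^+ k.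
Proof.
move=> x0 xy y1; have y0 := le_trans x0 xy.
pose f (z : R) m := (1 - z) * z ^+ (m - 1) * m%:R + z ^+ m.
have fS z m : f z m.+1 = z * f z m + (1 - z) * z ^+ m.
  rewrite /f subn1 /=; case: m => [|m]; first by rewrite !expr0 expr1; ring.
  by rewrite subn1 /= -[m.+2%:R]natr1 !exprS; ring.
rewrite -/(f x k) -/(f y k); elim: k => [|k IH]; first by rewrite /f !mulr0.
rewrite !fS.
have h1 : x * f x k <= x * f y k by rewrite ler_wpM2l.
have h2 : (1 - x) * x ^+ k <= (1 - x) * y ^+ k.
  by rewrite ler_wpM2l ?subr_ge0 ?(le_trans xy)// lerXn2r.
(* What is left after replacing x by y in [f] and in the power; it is nonnegative since at most one
   success is likelier than none. *)
have h3 : 0 <= (y - x) * (f y k - y ^+ k).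
  by rewrite mulr_ge0 ?subr_ge0// /f lerDr !mulr_ge0 ?exprn_ge0 ?subr_ge0.
lra.
Qed.

(** The full series is the mean of a sum of two geometric variables; the closed form of its partial
    sums shows what is dropped. *)
Lemma sum_two_success_tail_le (R : realType) (y : R) n : 0 <= y -> y < 1 ->
  \sum_(0 <= k < n) ((1 - y) * y ^+ (k - 1) * k%:R + y ^+ k) <= 2 / (1 - y).
Proof.
move=> y0 y1; rewrite ler_pdivlMr ?subr_gt0//.
have -> : (\sum_(0 <= k < n) ((1 - y) * y ^+ (k - 1) * k%:R + y ^+ k)) * (1 - y) =
    2 - 2 * y ^+ n - n%:R * y ^+ (n - 1) * (1 - y).
  elim: n => [|n IH]; first by rewrite big_nil expr0; ring.
  rewrite big_nat_recr//= mulrDl IH subn1 /=.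
  case: n {IH} => [|n]; first by rewrite !expr0 expr1; ring.
  by rewrite subn1 /= -[n.+2%:R]natr1 !exprS; ring.
have h1 : 0 <= y ^+ n by rewrite exprn_ge0.
have h2 : 0 <= n%:R * y ^+ (n - 1) * (1 - y).
  by rewrite !mulr_ge0 ?exprn_ge0 ?subr_ge0 ?(ltW y1).
lra.
Qed.

Lemma count_iota_le1P (e : pred nat) k :
  reflect (forall i j, (i < j < k)%N -> e i -> ~~ e j)
          (count e (iota 0 k) <= 1)%N.
Proof.
apply: (iffP idP) => [h i j /andP[ij jk] ei|h].
  apply/negP => ej; move: h; rewrite leqNgt => /negP; apply.
  rewrite -size_filter; apply: (@uniq_leq_size _ [:: i; j]).
    by rewrite /= inE neq_ltn ij.
  move=> m; rewrite !inE mem_filter mem_iota add0n /= => /orP[]/eqP ->.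
    by rewrite ei (ltn_trans ij).
  by rewrite ej.
rewrite -size_filter; case E : [seq _ <- _ | _] => [//|a [//|a' s]].
have : sorted ltn [seq x <- iota 0 k | e x].
  by rewrite sorted_filter ?iota_ltn_sorted//; exact: ltn_trans.
have mem m : m \in [:: a, a' & s] -> e m && (m < k)%N.
  by rewrite -E mem_filter mem_iota add0n.
rewrite E /= => /andP[aa' _].
have /andP[ea _] := mem a (mem_head _ _).
have /andP[ea' a'k] : e a' && (a' < k)%N by apply: mem; rewrite !inE eqxx orbT.
by have := h a a'; rewrite aa' a'k ea ea' => /(_ isT isT).
Qed.

(** * The iteration count in terms of coalescing blocks *)

Section running_time.
Context {R : realType}.

Lemma ereal_inf_nat_min (A : set nat) n : A n -> (forall m, A m -> (n <= m)%N) ->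
  ereal_inf [set l%:R%:E | l in A] = n%:R%:E :> \bar R.
Proof.
move=> An nA; apply/eqP; rewrite eq_le; apply/andP; split.
  by apply: ereal_inf_lbound; exists n.
by apply: le_ereal_inf_tmp => _ [m Am <-]; rewrite lee_fin ler_nat nA.
Qed.

Variables (N : nat) (dist : nat -> R) (B : nat) (u : int -> R).
Local Notation e := (coalesces N dist B u).
Local Notation L := (iterations_ii N dist B u).
Local Notation L' := (iterations_iii N dist B u).

(** Blocks being numbered from 0, the second coalescing one has index L + L' - 1. The infinite case
    is that of fewer than two coalescing blocks. *)
Lemma iterations_spec :
  (exists2 n, (L + L')%E = n%:R%:E &
     forall k, (count e (iota 0 k) <= 1)%N = (k < n)%N) \/
  ((L + L')%E = +oo%E /\ forall k, (count e (iota 0 k) <= 1)%N).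
Proof.
have [/cid[j0 ej0]|no] := pselect (exists j, e j); last first.
  right; split=> [|k]; last first.
    by apply/count_iota_le1P => i j _ ei; case: no; exists i.
  have -> : L = +oo%E.
    rewrite /iterations_ii (_ : [set l | _] = set0) ?image_set0 ?ereal_inf0//.
    by apply/seteqP; split => // l [_ el]; case: no; exists (l - 1)%N.
  rewrite addye// gt_eqF// (lt_le_trans ltNy0)//.
  by apply: le_ereal_inf_tmp => _ [m _ <-]; rewrite lee_fin.
case: (ex_minnP (ex_intro _ j0 ej0)) => i ei imin {j0 ej0}.
have LE : L = i.+1%:R%:E.
  apply: ereal_inf_nat_min; first by rewrite /= subn1.
  by move=> l [l1 /imin]; lia.
have L'E : L' = ereal_inf [set l'%:R%:E | l' in
    [set l' | (1 <= l')%N /\ e (i + l')%N]].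
  rewrite /iterations_iii LE; congr (ereal_inf (_ @` _)).
  apply/seteqP; split => l' /= [l1].
    move=> [l [/eqP]]; rewrite eqr_nat => /eqP <-.
    by rewrite addSn subn1.
  by move=> el; split => //; exists i.+1 => //; rewrite addSn subn1.
have [/cid[l0 [l01 el0]]|no] := pselect (exists l', (1 <= l')%N /\ e (i + l')%N).
  have hex : exists l', (0 < l')%N && e (i + l')%N by exists l0; rewrite l01.
  case: (ex_minnP hex) => l /andP[l1 el] lmin; left; exists (i.+1 + l)%N.
    rewrite LE L'E (@ereal_inf_nat_min _ l)// -?EFinD ?natrD// => m [m1 em].
    by apply: lmin; rewrite m1.
  move=> k; apply/count_iota_le1P/idP => [h|kl a b /andP[ab bk] ea].
    rewrite ltnNge; apply/negP => kl; have il : (i < i + l < k)%N by lia.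
    by have := h _ _ il ei; rewrite el.
  have ia := imin _ ea; apply/negP => eb.
  by have := lmin (b - i)%N; rewrite subnKC ?eb ?andbT ?subn_gt0; lia.
right; split=> [|k].
  rewrite L'E (_ : [set l' | _] = set0) ?image_set0 ?ereal_inf0 ?LE//.
  by apply/seteqP; split => // l h; case: no; exists l.
apply/count_iota_le1P => a b /andP[ab _] ea; apply/negP => eb.
have ia := imin _ ea; case: no; exists (b - i)%N; rewrite subnKC; last by lia.
by split => //; lia.
Qed.

Lemma iterations_gt k : (k%:R%:E < L + L')%E = (count e (iota 0 k) <= 1)%N.
Proof.
case: iterations_spec => [[n -> ->]|[-> ->]]; last by rewrite ltry.
by rewrite lte_fin ltr_nat.
Qed.

(** Layer-cake formula: n is the sum over k of the indicators of k < n. *)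
Lemma iterations_series :
  (L + L' = \sum_(0 <= k <oo) ((count e (iota 0 k) <= 1)%N%:R : R)%:E)%E.
Proof.
case: iterations_spec => [[n -> h]|[-> h]]; apply/esym.
  apply: lim_near_cst => //; near=> m.
  have nm : (n <= m)%N by near: m; exact: nbhs_infty_ge.
  under eq_bigr do rewrite h; rewrite sumEFin (big_cat_nat (n := n))//=.
  have -> : \sum_(n <= k < m) (k < n)%N%:R = 0 :> R.
    by rewrite big_nat big1// => k /andP[nk _]; rewrite ltnNge nk.
  rewrite addr0 big_nat (eq_bigr (fun=> 1)) => [|k /andP[_ ->]//].
  by rewrite -big_nat big_const_nat iter_addr_0 subn0.
apply/eqyP => A A0; under eq_eseriesr do rewrite h.
apply: le_trans (nneseries_lim_ge (Num.truncn A).+1 _) => //.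
rewrite sumEFin big_const_nat iter_addr_0 subn0 lee_fin ltW// truncnS_gt.
Unshelve. all: by end_near. Qed.

End running_time.

(** * Optimal block factor, mean and tail of the running time *)

Lemma mean_boundE (R : realType) N (dist : nat -> R) b :
  mean_bound N dist b =
  2 * (ceil_theta N dist)%:R * N%:R * (b%:R / (1 - rate b)).
Proof. by rewrite /mean_bound; ring. Qed.

Theorem theorem3p1 (R : realType) (N : nat) (hN : (0 < N)%N)
  (dist : nat -> R)
  (dist_gt0 : forall i : nat, (i <= N)%N -> 0 < dist i)
  (dist_sum1 : \sum_(0 <= i < N.+1) dist i = 1)
  (d : measure_display) (T : measurableType d) (P : probability T R)
  (U : int -> {RV P >-> R}) (hU : iid_uniform U) :
  0 < theta N dist /\
  (forall b : nat, (0 < b)%N -> expR 1 < b%:R :> R ->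
    let T_R := fun w : T =>
      running_time N dist (block_size N dist b) (fun m => U m w) in
    [/\ 0 < (rate b : R) < 1,
        (\int[P]_w T_R w <= (mean_bound N dist b)%:E)%E &
        forall k : nat, (1 <= k)%N ->
          (P [set w | (block_size N dist b * k)%N%:R%:E < T_R w] <=
           ((1 - rate b) * rate b ^+ (k - 1) * k%:R + rate b ^+ k)%:E)%E]) /\
  [set b : nat | (3 <= b)%N /\
     forall b' : nat, (3 <= b')%N -> mean_bound N dist b <= mean_bound N dist b'] =
  [set 6%N].
Proof.
have ceil0 := ceil_theta_gt0 hN dist_gt0.
split; first exact: theta_gt0.
split; last first.
  have mean_lt b : (3 <= b)%N -> b != 6%N ->
      mean_bound N dist 6 < mean_bound N dist b.
    move=> b3 b6; rewrite !mean_boundE ltr_pM2l ?minimize_block_factor//.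
    by rewrite !mulr_gt0 ?ltr0n.
  apply/seteqP; split => [b [b3 bmin]|_ ->] /=.
    apply/eqP; apply/negP => /negP b6.
    by have := le_lt_trans (bmin 6%N isT) (mean_lt b b3 b6); rewrite ltxx.
  split => // b b3; have [->//|b6] := eqVneq b 6%N.
  exact/ltW/mean_lt.
move=> b b0 eb T_R; set B := block_size N dist b in T_R *.
have B0 : (0 < B)%N by rewrite !muln_gt0 b0 ceil0.
have r0 := rate_gt0 R b; have r1 := rate_lt1 eb.
set tail := fun k => (1 - rate b) * rate b ^+ (k - 1) * k%:R + rate b ^+ k : R.
set S := fun k => [set w | (count (fun j => coalesces N dist B (fun m => U m w) j)
                              (iota 0 k) <= 1)%N].
have mS k : measurable (S k) by exact: measurable_le1_coalescence.
have PS k : (P (S k) <= (tail k)%:E)%E.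
  rewrite prob_le1_coalescence// lee_fin two_success_tail_le ?(ltW r1)//.
    exact: failure_ge0.
  exact: failure_le_rate hU _.
split; first by rewrite r0 r1.
(* Integrating the layer-cake series term by term reduces the mean to the probabilities of the
   events [S k]. *)
- have -> : (\int[P]_w T_R w =
    \int[P]_w (B%:R%:E * \sum_(0 <= k <oo) (\1_(S k) w)%:E))%E.
    apply: eq_integral => w _; rewrite /T_R /running_time iterations_series muleC.
    congr (_ * _)%E; apply: eq_eseriesr => k _.
    by rewrite indicE; congr (_%:R%:E); apply/esym; rewrite mem_setE.
  rewrite ge0_integralZl_EFin//=; last 2 first.
  + by move=> w _; apply: nneseries_ge0 => k _ _; rewrite lee_fin.
  + apply: ge0_emeasurable_sum => k //.
    by move=> _; apply/measurable_realfun.measurable_EFinP;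
      exact: measurable_realfun.measurable_indic.
  rewrite integral_nneseries//; last first.
    by move=> k; apply/measurable_realfun.measurable_EFinP;
      exact: measurable_realfun.measurable_indic.
  have -> : mean_bound N dist b = B%:R * (2 / (1 - rate b)).
    by rewrite mean_boundE /B /block_size !natrM; ring.
  rewrite EFinM lee_wpmul2l ?lee_fin//.
  apply: lime_le.
    apply: is_cvg_nneseries => k _ _; apply: integral_ge0 => w _.
    by rewrite lee_fin.
  near=> n; apply: (@le_trans _ _ (\sum_(0 <= k < n) (tail k)%:E)%E).
    by apply: lee_sum => k _; rewrite integral_indic// setIT PS.
  by rewrite sumEFin lee_fin sum_two_success_tail_le// ltW.
(* The event that T_R exceeds B k is exactly [S k]. *)
move=> k k1; apply: le_trans (PS k); rewrite le_eqVlt; apply/orP; left.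
have SE w : ((B * k)%N%:R%:E < T_R w)%E =
    (count (fun j => coalesces N dist B (fun m => U m w) j) (iota 0 k) <= 1)%N.
  rewrite /T_R /running_time [RHS](esym (iterations_gt _ _ _ _ _)) natrM EFinM.
  by rewrite muleC lte_pmul2r// lte_fin ltr0n.
by apply/eqP; congr (P _); apply/seteqP; split => w /=; rewrite SE.
Unshelve. all: by end_near. Qed.
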